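(* Let $(\mathcal{F},\tau_2)$ be a Hausdorff topological $\widetilde{\mathbb{C}}$-module with the property that, for every barrelled $\widetilde{\mathbb{C}}$-module $(\mathcal{G},\tau_1)$, every closed $\widetilde{\mathbb{C}}$-linear map from $(\mathcal{G},\tau_1)$ to $(\mathcal{F},\tau_2)$ is continuous. Then $(\mathcal{F},\tau_2)$ is an infra-s $\widetilde{\mathbb{C}}$-module.
   Context: A map is closed if its graph is closed in the product space $\mathcal{G}\times\mathcal{F}$. ''Coarser'' and ''finer'' are meant non-strictly; $\tau\prec\tau'$ means that $\tau$ is coarser than $\tau'$. Generalized numbers: $\widetilde{\mathbb{C}}=\mathcal{E}_M/\mathcal{N}$, where $\mathcal{E}_M$ is the ring of nets $(c_\varepsilon)_\varepsilon\in\mathbb{C}^{(0,1]}$ with $|c_\varepsilon|=O(\varepsilon^{-N})$ as $\varepsilon\to0$ for some $N\in\mathbb{N}$, and $\mathcal{N}$ is the ideal of nets with $|c_\varepsilon|=O(\varepsilon^{q})$ for all $q\in\mathbb{N}$; $[(c_\varepsilon)_\varepsilon]$ denotes the class of $(c_\varepsilon)_\varepsilon$. The valuation is $\mathrm{v}(c)=\sup\{b\in\mathbb{R}: |c_\varepsilon|=O(\varepsilon^b)\text{ as }\varepsilon\to0\}$ and $|c|_{\mathrm e}=e^{-\mathrm{v}(c)}$; $\widetilde{\mathbb{C}}$ carries the topology of the ultrametric $|c-d|_{\mathrm e}$. A topological $\widetilde{\mathbb{C}}$-module is a $\widetilde{\mathbb{C}}$-module with a $\widetilde{\mathbb{C}}$-linear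 topology, i.e. one making addition and scalar multiplication $\widetilde{\mathbb{C}}\times\mathcal{G}\to\mathcal{G}$ continuous. A subset $A$ of a $\widetilde{\mathbb{C}}$-module $\mathcal{G}$ is balanced if $\lambda A\subseteq A$ whenever $|\lambda|_{\mathrm e}\le1$; absorbent if for every $u\in\mathcal{G}$ there is $a\in\mathbb{R}$ with $u\in[(\varepsilon^b)_\varepsilon]A$ for all $b\le a$. A string in $\mathcal{G}$ is a sequence $(U_n)_{n\ge1}$ of balanced and absorbent subsets of $\mathcal{G}$ (its knots) with $U_{n+1}+U_{n+1}\subseteq U_n$ for all $n$ and $[(\varepsilon^{-n})_\varepsilon]U_{n+p}\subseteq U_p$ for all $n,p\ge1$. In a topological $\widetilde{\mathbb{C}}$-module a string is closed if every knot is closed, and topological if every knot is a neighborhood of $0$. A topological $\widetilde{\mathbb{C}}$-module (or its topology) is barrelled if every closed string in it is topological. For a $\widetilde{\mathbb{C}}$-linear topology $\tau$ on $\mathcal{F}$, the associated barrelled topology $\tau^t$ is the coarsest barrelled $\widetilde{\mathbb{C}}$-linear topology on $\mathcal{F}$ finer than $\tau$ (it exists). A Hausdorff topological $\widetilde{\mathbb{C}}$-module $(\mathcal{F},\tau_0)$ is an infra-s $\widetilde{\mathbb{C}}$-module if for every Hausdorff $\widetilde{\mathbb{C}}$-linear topology $\tau$ on $\mathcal{F}$ coarser than $\tau_0$ one has $\tau_0\prec\tau^t$. *)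

(* Defs.v *)
From HB Require Import structures.
From mathcomp Require Import all_boot all_order all_algebra.
From mathcomp Require Import generic_quotient ring_quotient.
From mathcomp Require Import complex.
From mathcomp Require Import all_classical all_reals all_analysis.

Set Implicit Arguments.
Unset Strict Implicit.
Unset Printing Implicit Defensive.

Import Order.TTheory GRing.Theory Num.Theory.

Local Open Scope classical_set_scope.
Local Open Scope quotient_scope.
Local Open Scope complex_scope.
Local Open Scope ring_scope.

Section IndexSet.
Variable R : realType.

Definition eps01 := {e : R | (0 < e <= 1)%R}.

Fact eps01_one_subproof : (0 < (1 : R) <= 1)%R.
Proof. by rewrite ltr01 lexx. Qed.

HB.instance Definition _ := Choice.on eps01.
HB.instance Definition _ :=
  isPointed.Build eps01 (exist _ 1 eps01_one_subproof).

Lemma eps_gt0 (e : eps01) : 0 < val e.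
Proof. by case: e => e /= /andP[]. Qed.

Lemma eps_le1 (e : eps01) : val e <= 1.
Proof. by case: e => e /= /andP[]. Qed.

End IndexSet.

Notation normc := ComplexField.Normc.normc.

Section Nets.
Variable R : realType.

Local Notation net := (eps01 R -> R[i]).
Implicit Types (c d : net) (a b K : R).

(* |c_e| = O(e ^ b) as e -> 0; [normc] is the real-valued complex modulus. *)
Definition bigO b c : Prop :=
  exists K : R, exists2 eta : R, 0 < eta &
    forall e : eps01 R, val e <= eta -> normc (c e) <= K * val e `^ b.

Definition moderate : {pred net} :=
  fun c => `[< exists N : nat, bigO (- N%:R) c >].

Definition negligible c : Prop := forall q : nat, bigO q%:R c.

Lemma bigO_ge0 b c : bigO b c -> exists2 K : R, 0 <= K &
  exists2 eta : R, 0 < eta &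
    forall e : eps01 R, val e <= eta -> normc (c e) <= K * val e `^ b.
Proof.
move=> [K [eta eta0 h]]; exists `|K|; first exact: normr_ge0.
exists eta => // e /h/le_trans; apply.
by rewrite ler_wpM2r ?powR_ge0 ?ler_norm.
Qed.

Lemma bigO_le a b c : a <= b -> bigO b c -> bigO a c.
Proof.
move=> ab /bigO_ge0[K K0 [eta eta0 h]]; exists K, eta => // e /h/le_trans; apply.
by rewrite ler_wpM2l // ger_powR // eps_gt0 eps_le1.
Qed.

Lemma bigO0 b : bigO b (0 : net).
Proof.
exists 0, 1 => // e _; rewrite mul0r -[X in normc X]/(0 : R[i]).
by rewrite ComplexField.Normc.normc0.
Qed.

Lemma bigOD b c d : bigO b c -> bigO b d -> bigO b (c + d).
Proof.
move=> [K [s s0 hc]] [L [t t0 hd]]; exists (K + L), (Num.min s t).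
  by rewrite lt_min s0.
move=> e; rewrite le_min => /andP[/hc ec /hd ed].
by rewrite (le_trans (le_normcD _ _)) // mulrDl lerD.
Qed.

Lemma bigON b c : bigO b c -> bigO b (- c).
Proof.
move=> [K [s s0 hc]]; exists K, s => // e /hc.
by rewrite -[(- c) e]/(- c e) normcN.
Qed.

Lemma bigOB b c d : bigO b c -> bigO b d -> bigO b (c - d).
Proof. by move=> ? ?; apply: bigOD => //; apply: bigON. Qed.

Lemma bigOM a b c d : bigO a c -> bigO b d -> bigO (a + b) (c * d).
Proof.
move=> /bigO_ge0[K K0 [s s0 hc]] /bigO_ge0[L L0 [t t0 hd]].
exists (K * L), (Num.min s t); first by rewrite lt_min s0.
move=> e; rewrite le_min => /andP[/hc ec /hd ed].
rewrite -[(c * d) e]/(c e * d e) ComplexField.Normc.normcM.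
rewrite powRD; last by rewrite (gt_eqF (eps_gt0 e)) implybT.
by rewrite mulrACA ler_pM // /normc; case: (c e) (d e) => ? ? [? ?];
  rewrite sqrtr_ge0.
Qed.

(* [(e ^ b)_e]: a moderate net for every real exponent b. *)
Definition eps_pow b : net := fun e => (val e `^ b)%:C.

Lemma bigO_eps_pow b : bigO b (eps_pow b).
Proof.
exists 1, 1 => // e _; rewrite mul1r /normc /= expr0n /= addr0 sqrtr_sqr.
by rewrite ger0_norm // powR_ge0.
Qed.

Lemma bigO_moderate b c : bigO b c -> c \in moderate.
Proof.
move=> h; apply/asboolP; exists (Num.truncn `|b|).+1; apply: bigO_le h.
rewrite lerNl (le_trans (ler_norm _)) // normrN.
exact/ltW/truncnS_gt.
Qed.

Lemma eps_pow_moderate b : eps_pow b \in moderate.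
Proof. exact: bigO_moderate (bigO_eps_pow b). Qed.

Lemma bigO1 : bigO 0 (1 : net).
Proof.
have -> : (1 : net) = eps_pow 0; last exact: bigO_eps_pow.
by apply/funext => e; rewrite /eps_pow powRr0.
Qed.

Lemma negligible_bigO b c : negligible c -> bigO b c.
Proof.
move=> /(_ (Num.truncn `|b|).+1); apply: bigO_le.
by rewrite (le_trans (ler_norm _)) // ltW // truncnS_gt.
Qed.

Lemma negligible1 : ~ negligible (1 : net).
Proof.
move=> /(_ 1%N) /bigO_ge0[K K0 [s s0 h]].
pose r := Num.min 1 (Num.min s (K + 1)^-1).
have r0 : 0 < r by rewrite !lt_min ltr01 s0 invr_gt0 ltr_wpDl.
have r1 : 0 < r <= 1 by rewrite r0 ge_min lexx.
have rs : r <= s by rewrite !ge_min lexx orbT.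
have := h (exist _ r r1) rs; rewrite -[X in normc X]/(1 : R[i]).
rewrite [val _]/= ComplexField.Normc.normc1.
rewrite powRr1 ?(ltW r0) // => hK.
have : 1 < 1 :> R; last by rewrite ltxx.
rewrite (le_lt_trans hK) // (@lt_le_trans _ _ ((K + 1) * r)) //.
  by rewrite ltr_pM2r // ltrDl.
rewrite -ler_pdivlMl ?ltr_wpDl // mulr1.
by rewrite !ge_min lexx !orbT.
Qed.

Fact moderate_subring_closed : subring_closed moderate.
Proof.
split.
- exact: bigO_moderate bigO1.
- move=> c d /asboolP[M hM] /asboolP[N hN].
  apply: (@bigO_moderate (- (M + N)%:R)).
  by apply: bigOB; [apply: bigO_le hM|apply: bigO_le hN];
    rewrite lerN2 ler_nat ?leq_addr ?leq_addl.
- move=> c d /asboolP[M hM] /asboolP[N hN].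
  exact: bigO_moderate (bigOM hM hN).
Qed.

HB.instance Definition _ :=
  GRing.isSubringClosed.Build net moderate moderate_subring_closed.

(* The ring E_M of moderate nets, and its ideal N of negligible nets. *)
Definition EM := {c : net | c \in moderate}.
HB.instance Definition _ := Choice.on EM.
HB.instance Definition _ := SubType.on EM.
HB.instance Definition _ := [SubChoice_isSubComNzRing of EM by <:].

Definition negl : {pred EM} := fun x => `[< negligible (val x) >].

Fact negl_idealr_closed : idealr_closed negl.
Proof.
split.
- by apply/asboolP => q; exact: bigO0.
- by apply/asboolP; exact: negligible1.
- move=> a u v /asboolP hu /asboolP hv; apply/asboolP => q.
  apply: bigOD; last exact: hv.
  have /asboolP[N hN] := valP a.
  have -> : q%:R = - N%:R + (N%:R + q%:R) :> R by rewrite addKr.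
  by apply: bigOM => //; exact: negligible_bigO.
Qed.

HB.instance Definition _ := isIdealr.Build EM negl negl_idealr_closed.

End Nets.

Section GeneralizedNumbers.
Variable R : realType.

Definition Ct := {ideal_quot (negl (R := R))}.
HB.instance Definition _ := GRing.ComNzRing.on Ct.
HB.instance Definition _ := Quotient.on Ct.

Definition Ceps_pow (b : R) : Ct :=
  \pi_Ct (exist _ (eps_pow b) (eps_pow_moderate b) : EM R).

Definition netv (c : eps01 R -> R[i]) : \bar R :=
  ereal_sup [set b%:E | b in [set b | bigO b c]].

(* The valuation of any representative, by [valuation_pi] below. *)
Definition valuation (x : Ct) : \bar R := netv (val (repr x : EM R)).

(* |x|_e = e ^ (- v(x)) *)
Definition normE (x : Ct) : R := fine (expeR (- valuation x)%E).

Lemma netv_le (c d : eps01 R -> R[i]) :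
  (forall b, bigO b c -> bigO b d) -> (netv c <= netv d)%E.
Proof.
move=> cd; apply: ge_ereal_sup => _ [b hb <-].
by apply: ereal_sup_ubound; exists b => //; exact: cd.
Qed.

Lemma Ct_eqP (c d : EM R) :
  \pi_Ct c = \pi_Ct d <-> negligible (val c - val d).
Proof.
split=> [/eqP|h].
  by rewrite -Quotient.idealrBE => /asboolP.
by apply/eqP; rewrite -Quotient.idealrBE; apply/asboolP.
Qed.

Lemma valuation_pi (c : EM R) : valuation (\pi_Ct c) = netv (val c).
Proof.
have h : negligible (val (repr (\pi_Ct c) : EM R) - val c).
  by apply/Ct_eqP; rewrite reprK.
apply/le_anti/andP; split; apply: netv_le => b hb.
  rewrite -(subKr (val (repr (\pi_Ct c) : EM R)) (val c)).
  by apply: bigOB => //; exact: negligible_bigO.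
rewrite -(subrK (val c) (val (repr (\pi_Ct c) : EM R))).
by apply: bigOD => //; exact: negligible_bigO.
Qed.

Lemma valuation_gtNy (x : Ct) : (-oo < valuation x)%E.
Proof.
have /asboolP[N hN] := valP (repr x : EM R).
by apply: (@lt_le_trans _ _ (- N%:R)%:E); rewrite ?ltNyr //;
  apply: ereal_sup_ubound; exists (- N%:R).
Qed.

Lemma bigO_valuation (b : R) (x : Ct) :
  (b%:E < valuation x)%E -> bigO b (val (repr x : EM R)).
Proof.
move=> /ereal_sup_gt[_ [a ha <-]]; rewrite lte_fin => /ltW.
by move=> /bigO_le; apply.
Qed.

Lemma valuation_eqy (x : Ct) : valuation x = +oo%E <-> x = 0.
Proof.
split=> [h|->].
  rewrite -[x]reprK -(rmorph0 \pi_Ct); apply/Ct_eqP => q.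
  by rewrite subr0; apply: bigO_valuation; rewrite h ltry.
rewrite -(rmorph0 \pi_Ct) valuation_pi; apply/eqyP => b b0.
by apply: ereal_sup_ubound; exists b => //; exact: bigO0.
Qed.

Lemma valuationN (x : Ct) : valuation (- x) = valuation x.
Proof.
rewrite -[x]reprK -rmorphN !valuation_pi.
by apply/le_anti/andP; split; apply: netv_le => b /bigON; rewrite ?opprK.
Qed.

Lemma valuationD (x y : Ct) :
  (Order.min (valuation x) (valuation y) <= valuation (x + y)%R)%E.
Proof.
rewrite leNgt; apply/negP => xy.
have [b hb] : exists2 b : R, (valuation (x + y)%R < b%:E)%E &
    (b%:E < Order.min (valuation x) (valuation y))%E.
  move: xy (valuation_gtNy (x + y)); case: (valuation _) => [s| |] //.
    case: (Order.min _ _) => [t| |] //.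
      rewrite lte_fin => st _; exists ((s + t) / 2); rewrite lte_fin;
      [exact: (midf_lt st).1|exact: (midf_lt st).2].
    by move=> _ _; exists (s + 1); rewrite ?ltry // lte_fin ltrDl.
  by rewrite ltNge leey.
rewrite lt_min => /andP[/bigO_valuation bx /bigO_valuation by_].
move: hb; rewrite ltNge => /negP; apply.
rewrite -{1}[x]reprK -{1}[y]reprK -rmorphD valuation_pi.
by apply: ereal_sup_ubound; exists b => //; exact: bigOD.
Qed.

(* The valuation is never -oo, so [fine] in [normE] loses nothing. *)
Lemma normEE (x : Ct) : (normE x)%:E = expeR (- valuation x)%E.
Proof. by rewrite /normE; have := valuation_gtNy x; case: (valuation x). Qed.

Lemma normE_ge0 (x : Ct) : 0 <= normE x.
Proof. by rewrite -lee_fin normEE expeR_ge0. Qed.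

Lemma normE_eq0 (x : Ct) : normE x = 0 <-> x = 0.
Proof.
rewrite -valuation_eqy; split=> [h|h].
  have /eqP : (normE x)%:E = 0%E by rewrite h.
  rewrite normEE expeR_eq0.
  by rewrite eqe_oppLR => /eqP.
by apply: EFin_inj; rewrite normEE h.
Qed.

Lemma normEN (x : Ct) : normE (- x) = normE x.
Proof. by rewrite /normE valuationN. Qed.

Lemma normED (x y : Ct) : normE (x + y) <= Num.max (normE x) (normE y).
Proof.
rewrite -lee_fin EFin_max !normEE le_max !lee_expeR !leeN2 -ge_min.
exact: valuationD.
Qed.

Definition distE (x y : Ct) : R := normE (x - y).

Let distE_refl x : distE x x = 0.
Proof. by rewrite /distE subrr; exact/normE_eq0. Qed.

Let distE_pos x y : distE x y = 0 -> x = y.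
Proof. by move/normE_eq0/eqP; rewrite subr_eq0 => /eqP. Qed.

Let distE_sym x y : distE x y = distE y x.
Proof. by rewrite /distE -normEN opprB. Qed.

Let distE_triangle y x z : distE x z <= distE x y + distE y z.
Proof.
rewrite /distE -[x - z](subrKA y) (le_trans (normED _ _)) //.
by rewrite ge_max lerDl lerDr !normE_ge0.
Qed.

HB.instance Definition _ :=
  @isMetric.Build R Ct distE distE_refl distE_pos distE_sym distE_triangle.
End GeneralizedNumbers.

(* As in the library's [sup_topology], a topology on X is a class
   [tau : Topological X]; [tspace tau] is X equipped with tau, so that several
   topologies on one module can be handled at once.  The class also carries a
   choice structure, which plays no role. *)
Definition tspace (X : Type) (tau : Topological X) : topologicalType :=
  Topological.Pack tau.

Definition coarser (X : Type) (tau tau' : Topological X) : Prop :=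
  forall A : set X, open (A : set (tspace tau)) -> open (A : set (tspace tau')).

Section TopologicalModules.
Variables (R : realType) (G : lmodType (Ct R)).
Implicit Types (tau : Topological G) (A : set G) (U : nat -> set G).

Definition linear_topology tau : Prop :=
  continuous (fun p : tspace tau * tspace tau =>
    ((p.1 : G) + (p.2 : G) : tspace tau)) /\
  continuous (fun p : Ct R * tspace tau => (p.1 *: (p.2 : G) : tspace tau)).

Definition balanced A : Prop :=
  forall (l : Ct R) (u : G), normE l <= 1 -> A u -> A (l *: u).

Definition absorbent A : Prop :=
  forall u : G, exists a : R, forall b : R, b <= a ->
    [set Ceps_pow b *: w | w in A] u.

(* Strings are indexed by n >= 1; the value U 0 is irrelevant. *)
Definition is_string U : Prop :=
  [/\ forall n, (1 <= n)%N -> balanced (U n) /\ absorbent (U n),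
      forall n, (1 <= n)%N ->
        [set u + v | u in U n.+1 & v in U n.+1] `<=` U n &
      forall n p, (1 <= n)%N -> (1 <= p)%N ->
        [set Ceps_pow (- n%:R) *: u | u in U (n + p)%N] `<=` U p].

Definition closed_string tau U : Prop :=
  is_string U /\ forall n, (1 <= n)%N -> closed (U n : set (tspace tau)).

Definition topological_string tau U : Prop :=
  is_string U /\ forall n, (1 <= n)%N -> @nbhs _ (tspace tau) (0 : G) (U n).

Definition barrelled tau : Prop :=
  linear_topology tau /\
  forall U, closed_string tau U -> topological_string tau U.

Definition associated_barrelled tau taut : Prop :=
  [/\ barrelled taut, coarser tau taut &
      forall sigma, barrelled sigma -> coarser tau sigma -> coarser taut sigma].

Definition hausdorff_topology tau : Prop := hausdorff_space (tspace tau).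

(* The associated barrelled topology is determined up to its open sets by
   [associated_barrelled]; being a class, [taut] itself is not unique, hence
   the existential. *)
Definition infra_s tau0 : Prop :=
  [/\ linear_topology tau0, hausdorff_topology tau0 &
      forall tau, linear_topology tau -> hausdorff_topology tau ->
        coarser tau tau0 ->
        exists2 taut, associated_barrelled tau taut & coarser tau0 taut].

End TopologicalModules.

Definition closed_map (X Y : Type) (tau : Topological X) (sigma : Topological Y)
    (f : X -> Y) : Prop :=
  closed ([set p | p.2 = f p.1] : set (tspace tau * tspace sigma)).

Definition continuous_map (X Y : Type) (tau : Topological X)
    (sigma : Topological Y) (f : X -> Y) : Prop :=
  continuous (f : tspace tau -> tspace sigma).

(* Main.v *)
From HB Require Import structures.
Require Import Defs.
From mathcomp Require Import all_boot all_order all_algebra.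
From mathcomp Require Import generic_quotient complex.
From mathcomp Require Import all_classical all_reals all_analysis.

(** Apply the hypothesis to the identity map, from [F] with the associated
    barrelled topology [taut] of a coarser Hausdorff topology [tau] to
    [(F, tau2)].  Its graph is the diagonal of [F], which is closed in
    [tau * tau] because [tau] is Hausdorff, hence in the finer
    [taut * tau2] ([closed_diagonal]).  So the identity is continuous, which
    says that [tau2] is coarser than [taut].

    The real work is the existence of [taut].  It is obtained as the infimum,
    in the lattice of linear topologies, of all barrelled topologies finer than
    [tau].  The infimum of a family [S] is described by strings: its
    0-neighborhoods are the sets containing the first knot of a string whose
    knots are 0-neighborhoods for every member of [S].  Three facts make this
    work.
    - The axioms of a string are what is needed for such knots to define a
      linear topology ([linear_inf_linear]).
    - Conversely, every 0-neighborhood of a linear topology contains a string of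
      0-neighborhoods ([linear_nbhs_string]), so any linear topology coarser
      than all members of [S] is coarser than the infimum; in particular [tau]
      is.
    - The infimum of barrelled topologies is barrelled
      ([linear_inf_barrelled]): a string closed for the infimum is closed, hence
      topological, for each member, and therefore is one of the strings that
      generate the infimum. *)

Set Implicit Arguments.
Unset Strict Implicit.
Unset Printing Implicit Defensive.

Import Order.TTheory GRing.Theory Num.Theory.

Local Open Scope classical_set_scope.
Local Open Scope quotient_scope.
Local Open Scope ring_scope.

(** * The ultrametric of the ring of generalized numbers *)

Section GeneralizedNumbers.
Variable R : realType.
Implicit Types (x y l : Ct R) (a b K : R).

Lemma Ceps_powD a b : Ceps_pow a * Ceps_pow b = Ceps_pow (a + b) :> Ct R.
Proof.
rewrite /Ceps_pow -rmorphM; congr (\pi_(Ct R) _); apply: val_inj => /=.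
apply/funext => e; rewrite /eps_pow /= powRD; last first.
  by rewrite (gt_eqF (eps_gt0 e)) implybT.
by rewrite -[LHS]/(eps_pow a e * eps_pow b e) /eps_pow rmorphM.
Qed.

Lemma Ceps_pow0 : Ceps_pow 0 = 1 :> Ct R.
Proof.
rewrite /Ceps_pow -(rmorph1 \pi_(Ct R)); congr (\pi_(Ct R) _).
by apply: val_inj; apply/funext => e; rewrite /= /eps_pow powRr0.
Qed.

Lemma Ceps_powK b : Ceps_pow b * Ceps_pow (- b) = 1 :> Ct R.
Proof. by rewrite Ceps_powD subrr Ceps_pow0. Qed.

Lemma normE0 : normE (0 : Ct R) = 0.
Proof. exact/normE_eq0. Qed.

Lemma normE_Ceps_pow b : normE (Ceps_pow b : Ct R) <= expR (- b).
Proof.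
rewrite -lee_fin normEE -[(expR (- b))%:E]/(expeR (- b)%:E) lee_expeR.
rewrite EFinN leeN2 valuation_pi; apply: ereal_sup_ubound.
by exists b => //; exact: bigO_eps_pow.
Qed.

(** Exponents of growth add up under products; as the valuation is a supremum
    that need not be attained, the factors are estimated with exponents [e / 2]
    below their valuations. *)
Lemma normEM x y : normE (x * y) <= normE x * normE y.
Proof.
have [->|x0] := eqVneq x 0; first by rewrite mul0r normE0 mul0r.
have [->|y0] := eqVneq y 0; first by rewrite mulr0 normE0 mulr0.
rewrite -lee_fin EFinM !normEE -expeRD lee_expeR -fin_num_oppeD; last first.
  by rewrite fin_numE gt_eqF ?valuation_gtNy //=; apply/eqP => /valuation_eqy/eqP;
     exact/negP.
rewrite leeN2.
have vx : valuation x != +oo%E by apply/eqP => /valuation_eqy/eqP; exact/negP.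
have vy : valuation y != +oo%E by apply/eqP => /valuation_eqy/eqP; exact/negP.
have := @bigO_valuation _ ^~ x; have := @bigO_valuation _ ^~ y.
move: vx vy (valuation_gtNy x) (valuation_gtNy y).
case: (valuation x) => [r| |] //; case: (valuation y) => [s| |] // _ _ _ _ hy hx.
apply/lee_subgt0Pr => e e0.
have -> : valuation (x * y) = netv (val (repr x * repr y : Defs.EM R)).
  by rewrite -{1}[x]reprK -{1}[y]reprK -rmorphM valuation_pi.
apply: ereal_sup_ubound; exists ((r - e / 2) + (s - e / 2)).
  by apply: bigOM; [apply: hx|apply: hy]; rewrite lte_fin gtrBl divr_gt0.
by rewrite addrACA -opprD -splitr.
Qed.

Lemma normE_Ceps_powM b x : normE (Ceps_pow b * x) <= expR (- b) * normE x.
Proof.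
apply: le_trans (normEM _ _) _.
by rewrite ler_wpM2r ?normE_ge0 ?normE_Ceps_pow.
Qed.

(** Makes the decay of [Ceps_pow b] for large [b] explicit: together with
    [normE_Ceps_powM] it tells which [b] shrinks a ball of radius [K] into the
    unit ball. *)
Lemma expRN_mul_lt1 K b : K <= b -> expR (- b) * K < 1.
Proof.
move=> Kb; rewrite expRN ltr_pdivrMl ?expR_gt0 // mulr1.
by apply: le_lt_trans Kb _; rewrite (lt_le_trans _ (expR_ge1Dx b)) // ltrDr.
Qed.

Lemma nbhs_CtP l (A : set (Ct R)) :
  nbhs l A <-> exists2 d : R, 0 < d & forall x, normE (x - l) < d -> A x.
Proof.
split=> [/nbhs_ballP[d /= d0 h]|[d d0 h]].
  exists d => // x xl; apply: h; rewrite ballEmdist /=.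
  by rewrite -[mdist _ _]/(normE (l - x)) -normEN opprB.
apply/nbhs_ballP; exists d => //= x; rewrite ballEmdist /=.
by rewrite -[mdist _ _]/(normE (l - x)) -normEN opprB; exact: h.
Qed.

End GeneralizedNumbers.

(** * Neighborhoods of 0 in a linear topology *)

Section LinearTopology.
Variables (R : realType) (G : lmodType (Ct R)).
Implicit Types (tau : Topological G) (A W V : set G) (u v x : G).

(** For balanced sets, absorbing along the powers of epsilon is the same as
    absorbing along all small scalars, which is what continuity of
    [l |-> l *: u] at 0 speaks about. *)
Lemma absorbentP A : balanced A ->
  absorbent A <->
  forall u, exists2 d : R, 0 < d & forall l : Ct R, normE l < d -> A (l *: u).
Proof.
move=> bA; split=> [aA u|h u].
  have [a /(_ a (lexx a))[w Aw <-]] := aA u.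
  exists (expR a) => [|l la]; first exact: expR_gt0.
  rewrite scalerA mulrC; apply: bA => //.
  apply: le_trans (normE_Ceps_powM _ _) _.
  by rewrite expRN ler_pdivrMl ?expR_gt0 // mulr1 ltW.
have [d d0 hd] := h u; exists (- d^-1) => b bd.
exists (Ceps_pow (- b) *: u); last by rewrite scalerA Ceps_powK scale1r.
apply: hd; apply: le_lt_trans (normE_Ceps_pow _) _.
rewrite -[ltRHS]mul1r -ltr_pdivrMr //; apply: expRN_mul_lt1.
by rewrite lerNr.
Qed.

Definition balanced_core A : set G :=
  [set u | forall l : Ct R, normE l <= 1 -> A (l *: u)].

Lemma balanced_core_balanced A : balanced (balanced_core A).
Proof.
move=> l u l1 Au m m1; rewrite scalerA; apply: Au.
apply: le_trans (normEM _ _) _.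
by rewrite -[leRHS]mulr1 ler_pM ?normE_ge0.
Qed.

Lemma normE1_le1 : normE (1 : Ct R) <= 1.
Proof. by rewrite -Ceps_pow0 (le_trans (normE_Ceps_pow _)) // oppr0 expR0. Qed.

Lemma balanced_core_sub A : balanced_core A `<=` A.
Proof. by move=> u /(_ 1 normE1_le1); rewrite scale1r. Qed.

Section Neighborhoods.
Variable tau : Topological G.
Hypothesis tau_lin : linear_topology tau.

Local Notation nbhs_tau := (@nbhs _ (tspace tau)).

Lemma linear_nbhs_add x v A : nbhs_tau (x + v) A ->
  exists2 B, nbhs_tau x B & exists2 V, nbhs_tau v V &
    forall y w, B y -> V w -> A (y + w).
Proof.
move=> /(tau_lin.1 (x, v))[[B V] /= [Bx V0] BV]; exists B => //.
by exists V => // y w By Vw; exact: (BV (y, w)).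
Qed.

Lemma linear_nbhs_translate x v A :
  nbhs_tau (x + v) A -> nbhs_tau v [set w | A (x + w)].
Proof.
move=> /linear_nbhs_add[B /nbhs_singleton Bx [V Vv BV]].
by apply: filterS Vv => w Vw; exact: BV.
Qed.

Lemma linear_nbhs0P x A :
  nbhs_tau x A <-> nbhs_tau 0 [set u | A (x + u)].
Proof.
split=> [xA|A0]; first by apply: linear_nbhs_translate; rewrite addr0.
have : nbhs_tau (- x + x) [set u | A (x + u)] by rewrite addNr.
by move/linear_nbhs_translate; apply: filterS => w /=; rewrite addNKr.
Qed.

Lemma linear_nbhs_scale A : nbhs_tau 0 A ->
  exists2 d : R, 0 < d & exists2 V, nbhs_tau 0 V &
    forall (l : Ct R) u, normE l < d -> V u -> A (l *: u).
Proof.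
move=> A0; have : nbhs_tau ((0 : Ct R) *: (0 : G)) A by rewrite scaler0.
move=> /(tau_lin.2 (0, 0))[[B V] /= [/nbhs_CtP[d d0 Bd] V0] BV].
exists d => //; exists V => // l u ld Vu; apply: (BV (l, u)); split=> //=.
by apply: Bd; rewrite subr0.
Qed.

Lemma linear_nbhs_scalel l A :
  nbhs_tau 0 A -> nbhs_tau 0 [set u | A (l *: u)].
Proof.
move=> A0; have : nbhs_tau (l *: (0 : G)) A by rewrite scaler0.
move=> /(tau_lin.2 (l, 0))[[B V] /= [/nbhs_CtP[d d0 Bd] V0] BV].
apply: filterS V0 => u Vu; apply: (BV (l, u)); split=> //=.
by apply: Bd; rewrite subrr normE0.
Qed.

Lemma linear_nbhs_absorb A u : nbhs_tau 0 A ->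
  exists2 d : R, 0 < d & forall l : Ct R, normE l < d -> A (l *: u).
Proof.
move=> A0; have : nbhs_tau ((0 : Ct R) *: u) A by rewrite scale0r.
move=> /(tau_lin.2 (0, u))[[B V] /= [/nbhs_CtP[d d0 Bd] Vnbhs] BV].
have Vu : V u by exact: (@nbhs_singleton (tspace tau)).
exists d => // l ld; apply: (BV (l, u)); split=> //=.
by apply: Bd; rewrite subr0.
Qed.

(** Joint continuity at (0, 0) gives [l *: V `<=` A] for all small [l]; rescaling
    [V] by a small invertible [Ceps_pow b] turns this into all [l] of norm at
    most 1. *)
Lemma balanced_core_nbhs A : nbhs_tau 0 A -> nbhs_tau 0 (balanced_core A).
Proof.
move=> /linear_nbhs_scale[d d0 [V V0 dV]].
apply: filterS (linear_nbhs_scalel (Ceps_pow (- d^-1)) V0) => u /= Vu l l1.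
have -> : l *: u = (Ceps_pow d^-1 * l) *: (Ceps_pow (- d^-1) *: u).
  by rewrite scalerA mulrAC Ceps_powK mul1r.
apply: dV => //; apply: le_lt_trans (normE_Ceps_powM _ _) _.
apply: (@le_lt_trans _ _ (expR (- d^-1))).
  by rewrite -[leRHS]mulr1 ler_wpM2l ?expR_ge0.
by rewrite -[ltRHS]mul1r -ltr_pdivrMr //; exact: expRN_mul_lt1.
Qed.

(** The induction step for [linear_nbhs_string].  The premise on [W] is placed
    under the existential so that the axiom of choice gives a total function on
    sets, which can be iterated. *)
Lemma linear_nbhs_next_knot W : exists V, nbhs_tau 0 W ->
  [/\ nbhs_tau 0 V, balanced V,
      forall u v, V u -> V v -> W (u + v) &
      forall u, V u -> W (Ceps_pow (- 1) *: u)].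
Proof.
have [W0|nW] := pselect (nbhs_tau 0 W); last by exists W.
have : nbhs_tau (0 + 0) W by rewrite addr0.
move=> /linear_nbhs_add[B B0 [C C0 BC]].
exists (balanced_core (B `&` C `&` [set u | W (Ceps_pow (- 1) *: u)])) => _.
split.
- apply: balanced_core_nbhs; apply: filterI; [exact: filterI|exact: linear_nbhs_scalel].
- exact: balanced_core_balanced.
- move=> u v /balanced_core_sub[[Bu _] _] /balanced_core_sub[[_ Cv] _].
  exact: BC.
- by move=> u /balanced_core_sub[].
Qed.

(** Iterating the choice of a next knot, with [W] itself at index 0.  Only the
    scaling by [Ceps_pow (- 1)] has to be built in: composing [n] of them gives
    the one by [Ceps_pow (- n)]. *)
Lemma linear_nbhs_string W : nbhs_tau 0 W ->
  exists2 U, topological_string tau U & U 1%N `<=` W.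
Proof.
move=> W0; have [f fP] := choice linear_nbhs_next_knot.
pose U n := iter n f W.
have Unbhs n : nbhs_tau 0 (U n).
  by elim: n => //= n /fP[].
have /all_and4[_ Ubal Uadd Uscale] n := fP _ (Unbhs n).
(* [U 1 `<=` W] because [U 1 + U 1 `<=` W] and [U 1] contains 0. *)
exists U; last first.
  move=> u Uu; rewrite -[u]addr0; apply: (Uadd 0%N) => //.
  exact: nbhs_singleton (Unbhs 1%N).
split=> [|n _]; last exact: Unbhs.
split=> [[//|n] _|n _|n p _ _].
- split; first exact: Ubal.
  by apply/absorbentP => [|u]; [exact: Ubal|exact: linear_nbhs_absorb].
- by move=> _ [u Uu [v Uv <-]]; exact: Uadd.
- move=> _ [u Uu <-]; elim: n u Uu => [|n IHn] u Uu.
    by rewrite oppr0 Ceps_pow0 scale1r.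
  rewrite -natr1 opprD -Ceps_powD -scalerA; apply: IHn.
  exact: Uscale.
Qed.

End Neighborhoods.
End LinearTopology.

(** * Infima of linear topologies *)

Section LinearInfimum.
Variables (R : realType) (G : lmodType (Ct R)).
Implicit Types (tau sigma : Topological G) (A : set G) (U V : nat -> set G).
Implicit Types (S : Topological G -> Prop) (u v x : G).

Definition common_string S U : Prop :=
  is_string U /\ forall sigma, S sigma -> topological_string sigma U.

Lemma knot_balanced U n : is_string U -> (1 <= n)%N -> balanced (U n).
Proof. by case=> h _ _ /h[]. Qed.

Lemma knot_absorbs U n u : is_string U -> (1 <= n)%N ->
  exists2 d : R, 0 < d & forall l : Ct R, normE l < d -> U n (l *: u).
Proof. by case=> h _ _ /h[bU]; rewrite absorbentP //; exact. Qed.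

Lemma knot0 U n : is_string U -> (1 <= n)%N -> U n 0.
Proof.
move=> sU n1; have [d d0 h] := knot_absorbs 0 sU n1.
by rewrite -(scale0r 0); apply: h; rewrite normE0.
Qed.

Lemma knotD U n u v : is_string U -> (1 <= n)%N ->
  U n.+1 u -> U n.+1 v -> U n (u + v).
Proof. by case=> _ h _ /h UU Uu Uv; apply: UU; exists u => //; exists v. Qed.

(** The scaling axiom lets one pass from a small knot to a larger one by any
    bounded factor: write [l] as [Ceps_pow (- n)] times an element of norm at
    most 1. *)
Lemma knot_scale_bounded U p (K : R) : is_string U -> (1 <= p)%N ->
  exists2 n, (1 <= n)%N & forall (l : Ct R) u, normE l <= K -> U n u -> U p (l *: u).
Proof.
move=> sU p1; pose n := (Num.truncn `|K|).+1; exists (n + p)%N => // l u lK Uu.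
have -> : l *: u = Ceps_pow (- n%:R) *: ((Ceps_pow n%:R * l) *: u).
  by rewrite scalerA mulrCA mulrA mulrC [X in _ * X]Ceps_powK mulr1.
case: (sU) => _ _ /(_ n p isT p1); apply.
exists ((Ceps_pow n%:R * l) *: u) => //; apply: knot_balanced => //.
apply: le_trans (normE_Ceps_powM _ _) _; apply: ltW.
apply: expRN_mul_lt1; apply: le_trans lK _.
by rewrite (le_trans (ler_norm _)) // ltW // truncnS_gt.
Qed.

Lemma common_stringT S : common_string S (fun=> setT).
Proof.
have sT : is_string (fun=> [set: G]).
  split=> // n _; split=> // u; exists 0 => b _.
  by exists (Ceps_pow (- b) *: u); rewrite // scalerA Ceps_powK scale1r.
by split=> // sigma _; split=> // n _; exact: filterT.
Qed.

Lemma common_stringI S U V : common_string S U -> common_string S V ->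
  common_string S (fun n => U n `&` V n).
Proof.
move=> [sU tU] [sV tV]; have sUV : is_string (fun n => U n `&` V n).
  split=> [n n1|n n1|n p n1 p1].
  - have bUV : balanced (U n `&` V n).
      by move=> l u l1 [Uu Vu]; split; apply: knot_balanced.
    split=> //; apply/absorbentP => // u.
    have [d d0 hd] := knot_absorbs u sU n1.
    have [e e0 he] := knot_absorbs u sV n1.
    exists (Num.min d e) => [|l]; first by rewrite lt_min d0.
    by rewrite lt_min => /andP[/hd ? /he].
  - by move=> _ [u [Uu Vu] [v [Uv Vv] <-]]; split; exact: knotD.
  - move=> _ [u [Uu Vu] <-]; case: sU => _ _ /(_ n p n1 p1).
    by case: sV => _ _ /(_ n p n1 p1) hV hU; split; [apply: hU|apply: hV]; exists u.
split=> // sigma Ss; split=> // n n1.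
by apply: filterI; [exact: (tU _ Ss).2|exact: (tV _ Ss).2].
Qed.

Lemma common_string_shift S U k : common_string S U ->
  common_string S (fun n => U (k + n)%N).
Proof.
move=> [[bU dU eU] tU].
have le1 n : (1 <= n)%N -> (1 <= k + n)%N by move/leq_trans; apply; rewrite leq_addl.
have sU : is_string (fun n => U (k + n)%N).
  split=> [n /le1/bU //|n /le1/dU|n p n1 p1]; first by rewrite addnS.
  by rewrite addnCA; apply: eU => //; exact: le1.
by split=> // sigma Ss; split=> // n /le1; exact: (tU _ Ss).2.
Qed.

Definition string_open S : set_system G :=
  [set A | forall x, A x ->
     exists2 U, common_string S U & forall u, U 1%N u -> A (x + u)].

Fact string_openT S : string_open S setT.
Proof. by move=> x _; exists (fun=> setT) => //; exact: common_stringT. Qed.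

Fact string_openI S : setI_closed (string_open S).
Proof.
move=> A B oA oB x [/oA[U cU UA] /oB[V cV VB]].
exists (fun n => U n `&` V n); first exact: common_stringI.
by move=> u [/UA ? /VB].
Qed.

Fact string_open_bigU S (I : Type) (f : I -> set G) :
  (forall i, string_open S (f i)) -> string_open S (\bigcup_i f i).
Proof.
move=> of_ x [i _ /of_[U cU Uf]]; exists U => // u /Uf fu.
by exists i.
Qed.

(** [S] only serves to attach the topology: the topological structure found on
    the carrier [G] depends on it. *)
Definition string_space S : Type := G.

HB.instance Definition _ S := Choice.on (string_space S).
HB.instance Definition _ S := isOpenTopological.Build (string_space S)
  (string_openT S) (@string_openI S) (@string_open_bigU S).

Definition linear_inf S : Topological G := Topological.class (string_space S).

Lemma linear_inf_openE S A :
  open (A : set (tspace (linear_inf S))) = string_open S A.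
Proof. by []. Qed.

(** Open sets being defined by strings, the point is that [x + U 1] has [x] in
    its interior: the points around which [A] contains a translated first knot
    form an open set, since [U 2 + U 2 `<=` U 1] and a shifted string is again
    a string. *)
Lemma linear_inf_nbhsP S x A : @nbhs _ (tspace (linear_inf S)) x A <->
  exists2 U, common_string S U & forall u, U 1%N u -> A (x + u).
Proof.
split=> [|[U cU UA]].
  rewrite nbhsE => -[B [oB Bx] BA]; have [U cU UB] := oB x Bx.
  by exists U => // u /UB/BA.
rewrite nbhsE; exists [set y | exists2 V, common_string S V &
    forall u, V 1%N u -> A (y + u)]; last first.
  by move=> y [V [sV _] VA]; rewrite -[y]addr0; apply: VA; exact: knot0.
split; last by exists U.
move=> y [V cV VA]; exists (fun n => V (1 + n)%N).
  exact: common_string_shift.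
move=> u Vu; exists (fun n => V (1 + n)%N); first exact: common_string_shift.
by move=> v Vv; rewrite -addrA; apply: VA; apply: knotD cV.1 _ Vu Vv.
Qed.

Lemma linear_inf_knot S U n x : common_string S U -> (1 <= n)%N ->
  @nbhs _ (tspace (linear_inf S)) x [set y | U n (y - x)].
Proof.
case: n => // n cU _; apply/linear_inf_nbhsP.
exists (fun m => U (n + m)%N); first exact: common_string_shift.
by move=> u; rewrite addn1 /= addrC addKr.
Qed.

(** Continuity of scalar multiplication at [(l, x)] comes from
    [m *: z - l *: x = m *: (z - x) + (m - l) *: x]: the first term is small
    because [m] stays bounded, the second because knots are absorbent. *)
Lemma linear_inf_linear S : linear_topology (linear_inf S).
Proof.
split=> [[x y] A|[l x] A] /= /linear_inf_nbhsP[U cU UA]; have sU := cU.1.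
  exists ([set z | U 2%N (z - x)], [set z | U 2%N (z - y)]).
    by split; exact: linear_inf_knot.
  move=> [z w] /= [Uz Uw]; rewrite -[z + w](subrKC (x + y)); apply: UA.
  by rewrite opprD addrACA; exact: knotD.
have [n n1 Un] := knot_scale_bounded (normE l + 1) sU (isT : (1 <= 2)%N).
have [d d0 hd] := knot_absorbs x sU (isT : (1 <= 2)%N).
exists ([set m | normE (m - l) < Num.min d 1], [set z | U n (z - x)]).
  split; last exact: linear_inf_knot.
  by apply/nbhs_CtP; exists (Num.min d 1); rewrite // lt_min d0 ltr01.
move=> [m z] [] /=; rewrite lt_min => /andP[md m1] Uz.
rewrite -[m *: z](subrKC (l *: x)); apply: UA.
have -> : m *: z - l *: x = m *: (z - x) + (m - l) *: x.
  by rewrite scalerBr scalerBl addrA subrK.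
apply: knotD => //; last exact: hd.
apply: Un => //; rewrite -[m](subrK l) (le_trans (normED _ _)) //.
by rewrite ge_max lerDl ler01 andbT (le_trans (ltW m1)) // lerDr normE_ge0.
Qed.

Lemma linear_inf_coarser S sigma : S sigma -> linear_topology sigma ->
  coarser (linear_inf S) sigma.
Proof.
move=> Ss lin A oA; rewrite openE => x Ax; have [U cU UA] := oA x Ax.
apply/(linear_nbhs0P lin); apply: filterS UA _.
exact: (cU.2 _ Ss).2.
Qed.

(** A string of 0-neighborhoods for [tau] is one for every member of [S], so the
    strings found by [linear_nbhs_string] are generators of the infimum. *)
Lemma linear_inf_finest S tau : linear_topology tau ->
  (forall sigma, S sigma -> coarser tau sigma) -> coarser tau (linear_inf S).
Proof.
move=> lin tauS A oA; rewrite linear_inf_openE => x Ax.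
have /(linear_nbhs0P lin)/(linear_nbhs_string lin)[U [sU tU] UA] :
  @nbhs _ (tspace tau) x A by exact: open_nbhs_nbhs.
exists U => //; split=> // sigma Ss; split=> // n n1.
have := tU n n1; rewrite !nbhsE => -[B [oB B0] BU].
by exists B => //; split=> //; exact: tauS.
Qed.

Lemma coarser_closed tau sigma A : coarser tau sigma ->
  closed (A : set (tspace tau)) -> closed (A : set (tspace sigma)).
Proof.
by move=> ts /closed_openC/ts/open_closedC; rewrite setCK.
Qed.

(** The closed strings of the infimum are among the strings that generate it,
    because closedness passes from the infimum to the finer members of [S]. *)
Lemma linear_inf_barrelled S :
  (forall sigma, S sigma -> barrelled sigma) -> barrelled (linear_inf S).
Proof.
move=> bS; split=> [|U [sU cU]]; first exact: linear_inf_linear.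
have comU : common_string S U.
  split=> // sigma Ss; have [lin bar] := bS _ Ss.
  apply: bar; split=> // n n1.
  by apply: coarser_closed (cU n n1); exact: linear_inf_coarser.
split=> // n n1; have := linear_inf_knot 0 comU n1.
by apply: filterS => y /=; rewrite subr0.
Qed.

Lemma associated_barrelled_exists tau : linear_topology tau ->
  exists taut, associated_barrelled tau taut.
Proof.
move=> lin; exists (linear_inf (fun sigma => barrelled sigma /\ coarser tau sigma)).
split.
- by apply: linear_inf_barrelled => sigma [].
- by apply: linear_inf_finest => // sigma [].
- by move=> sigma bs ts; apply: linear_inf_coarser => //; case: bs.
Qed.

End LinearInfimum.

(** * The identity map has closed graph *)

Lemma closed_diagonal (R : realType) (G : lmodType (Ct R))
    (tau sigma rho : Topological G) :
  hausdorff_topology tau -> coarser tau sigma -> coarser tau rho ->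
  closed_map sigma rho (idfun : G -> G).
Proof.
move=> hau ts tr; rewrite /closed_map -openC openE => -[x y] /= yx.
have {}yx : (y : tspace tau) != x by apply/eqP.
move: hau; rewrite /hausdorff_topology open_hausdorff => /(_ _ _ yx).
move=> [[A B] /= [/set_mem Ay /set_mem Bx] [oA oB /eqP AB0]].
exists (B, A); first by split; apply: open_nbhs_nbhs; split=> //; [exact: ts|exact: tr].
move=> [z w] /= [Bz Aw] wz.
suff : (A `&` B) z by rewrite AB0.
by split=> //; rewrite -wz.
Qed.

Theorem proposition3p23 (R : realType) (F : lmodType (Ct R))
    (tau2 : Topological F) :
  linear_topology tau2 ->
  hausdorff_topology tau2 ->
  (forall (G : lmodType (Ct R)) (tau1 : Topological G), barrelled tau1 ->
     forall T : {linear G -> F},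
       closed_map tau1 tau2 T -> continuous_map tau1 tau2 T) ->
  infra_s tau2.
Proof.
move=> lin2 hau2 closed_graph; split=> // tau lin hau tau_tau2.
have [taut taut_assoc] := associated_barrelled_exists lin.
exists taut => //; have [bar tau_taut _] := taut_assoc.
have /continuousP id_cont : continuous_map taut tau2 (idfun : F -> F).
  apply: (closed_graph _ _ bar (idfun : {linear F -> F})).
  exact: closed_diagonal hau tau_taut tau_tau2.
by move=> A /id_cont.
Qed.
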